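(* Let $N,n,R$ be integers with $0<n<N$ and $0<R<N$. Let $X$ denote the number of red items among $n$ items drawn without replacement out of $N$ items of which $R$ are red. Put $\overline p:=\frac RN$, $m:=nR/N$, and for $\max(0,n+R-N)\le x\le\min(n,R)$ put $\hat p:=\frac xn$, $\hat q:=\frac{R-x}{N-n}$ and $$L(x):=n\left(\hat p\log\frac{\hat p}{\overline p}+(1-\hat p)\log\frac{1-\hat p}{1-\overline p}\right)+(N-n)\left(\hat q\log\frac{\hat q}{\overline p}+(1-\hat q)\log\frac{1-\hat q}{1-\overline p}\right).$$ Let $$C:=2\exp\left\{\frac{13}{12\,\overline p(1-\overline p)}\left(\frac1n+\frac1{N-n}\right)\right\}.$$ Then, for $x$ with $\max(0,n+R-N)\le x\le\min(n,R)$, $$\mathbb{P}(X\ge x)\le C(L(x)+2)\exp(-L(x))\qquad\text{for }x>m,$$ $$\mathbb{P}(X\le x)\le C(L(x)+2)\exp(-L(x))\qquad\text{for }x<m,$$ and $$\mathbb{P}(L(X)\ge x)\le2C(x+2)\exp(-x)\qquad\text{for all real }x>0.$$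
   Context: $\log$ is the natural logarithm and $0\log0:=0$. Drawing without replacement is uniform, i.e. $X$ is hypergeometric. The range $\max(0,n+R-N)\le x\le\min(n,R)$ of $x$ in the inequalities for $\mathbb{P}(X\ge x)$ and $\mathbb{P}(X\le x)$ is the range for which $L(x)$ is defined. *)

(* Defs.v *)
From HB Require Import structures.
From mathcomp Require Import all_boot all_order all_algebra.
From mathcomp Require Import all_classical all_reals all_analysis.

Set Implicit Arguments.
Unset Strict Implicit.
Unset Printing Implicit Defensive.

Import Order.TTheory GRing.Theory Num.Theory.
Local Open Scope classical_set_scope.
Local Open Scope ring_scope.

(* [D] is the set of items obtained by drawing [n] items without replacement
   from [T]: its law is uniform on the [n]-element subsets of [T]. *)
Definition uniform_draw (K : realType) (d : measure_display)
    (Omega : measurableType d) (P : probability Omega K)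
    (T : finType) (n : nat) (D : Omega -> {set T}) : Prop :=
  forall A : {set T},
    measurable [set w | D w = A] /\
    P [set w | D w = A] =
      (if #|A| == n then ('C(#|T|, n)%:R)^-1 else 0)%:E.

Definition red_drawn (Omega : Type) (T : finType) (red : {set T})
    (D : Omega -> {set T}) (w : Omega) : nat :=
  #|D w :&: red|.

(* The convention 0 log 0 = 0 holds automatically, as 0 * y = 0 and [ln] is
   total. *)
Definition bernoulli_divergence (K : realType) (a b : K) : K :=
  a * ln (a / b) + (1 - a) * ln ((1 - a) / (1 - b)).

Definition hyper_L (K : realType) (N n R : nat) (x : K) : K :=
  let pbar := R%:R / N%:R in
  let phat := x / n%:R in
  let qhat := (R%:R - x) / (N%:R - n%:R) in
  n%:R * bernoulli_divergence phat pbar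
    + (N%:R - n%:R) * bernoulli_divergence qhat pbar.

Definition hyper_C (K : realType) (N n R : nat) : K :=
  let pbar := R%:R / N%:R in
  2 * expR (13 / (12 * pbar * (1 - pbar)) * (n%:R^-1 + (N%:R - n%:R)^-1)).

(* Main.v *)
Require Import Defs.
From HB Require Import structures.
From mathcomp Require Import all_boot all_order all_algebra.
From mathcomp Require Import all_classical all_reals all_analysis.
From mathcomp Require Import ring lra zify.
Import Order.TTheory GRing.Theory Num.Theory.
Local Open Scope classical_set_scope.
Local Open Scope ring_scope.

(** Write the 2 x 2 table of the draw (red or not, drawn or not) with observed
    cells [x, n - x, R - x, N - n - R + x] and expected cells obtained at
    [x = m].  Then [L x] is the relative entropy [sum o ln (o / e)] of the
    observed cells [o] with respect to the expected cells [e].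

    By Stirling, the probability [h j] of drawing [j] red items is [exp (- L j)]
    times at most a constant times the square root of
    [s N^2 / (j (n - j) (R - j) (N - n - R + j))], where
    [s = n R (N - n) (N - R) / N^3] and an empty cell counts as [1/5]
    ([hyper_pmf_sqr_le]).  On the other hand
    [L] is convex and [exp (L' j)] is the odds ratio
    [rho = j (N - n - R + j) / ((n - j) (R - j))], so with
    [F t = (t + 2) exp (- t)] one has
    [F (L j) - F (L (j + 1)) >= (L j + 1) (1 - 1 / rho) exp (- L j)].
    The upper tail therefore telescopes to [C F (L k)] as soon as
    [h j exp (L j) <= C (L j + 1) (1 - 1 / rho)] for [m < j]
    ([hyper_pmf_telescope], [hyper_tail_le]).

    This last inequality ([hyper_pmf_le]) holds once [L j >= 3/2].  Put
    [d = j - m].  Since [1 - 1 / rho = N d / (j (N - n - R + j))] and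
    [s N = (n - m) (R - m)], its square amounts to a bound of the form
    [s + d ((n - m) / (n - j)) ((R - m) / (R - j)) <= (L + 1)^2 d^2 C^2],
    up to a constant factor on the left.
    The two ratios are at most linear in [L], because a cell that is much
    smaller than its expectation contributes a lot to the entropy
    ([padded_ratio_le]); and [s] is controlled by [3/2 <= L <= d^2 / s].  What
    remains is a quadratic inequality in [d] ([key_polynomial]), in which the
    exponential factor of [C], whose square is at least [4 (1 + 13 / (6 s))],
    takes care of small [d].  When [L <= 3/2] the bound is at least 1 and there is
    nothing to prove.

    The lower tail follows by exchanging the colours, and the bound for [L (X)]
    by adding both tails: [L] vanishes at [m] and is monotone on each side. *)

Ltac neq0 := repeat (apply/andP; split); apply: lt0r_neq0; lra.

Ltac by_eq := rewrite le_eqVlt; apply/orP; left; apply/eqP.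

(** * Two logarithmic inequalities *)

Lemma derivative_ge0 (K : realType) (f df : K -> K) (w : K) :
  1 <= w -> f 1 = 0 ->
  (forall x : K, 1 <= x -> is_derive x (1 : K) f (df x)) ->
  (forall x : K, 1 <= x -> 0 <= df x) -> 0 <= f w.
Proof.
move=> w1 f1 fdf df0; move: w1; rewrite le_eqVlt => /predU1P[<-|w1].
  by rewrite f1.
have [||c] := MVT w1 (f := f) (df := df).
- by move=> x; rewrite in_itv /= => /andP[/ltW x1 _]; exact: fdf.
- apply: derivable_within_continuous => x; rewrite in_itv /= => /andP[x1 _].
  by have := fdf _ x1 => /@ex_derive.
rewrite in_itv /= f1 subr0 => /andP[/ltW c1 _] ->.
by rewrite mulr_ge0 ?df0 // subr_ge0 ltW.
Qed.

(** The integral of [1/t] over [[1, w]] is at most its trapezoidal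
    approximation, by convexity; with [w := e / o] and [w := (a + 1) / a] this
    gives both the quadratic lower bound on a cell and the lower Stirling
    bound. *)
Lemma ln_le_trapezoid (K : realType) (w : K) :
  1 <= w -> ln w <= (w - w^-1) / 2.
Proof.
move=> w1; rewrite -subr_ge0.
apply: (@derivative_ge0 K (fun w => (w - w^-1) / 2 - ln w)
          (fun w => (1 + w^-1 ^+ 2) / 2 - w^-1)) => //.
- by rewrite ln1 invr1 subrr mul0r subrr.
- move=> x x1; have x0 : 0 < x by lra.
  have xn0 : x != 0 by rewrite gt_eqF.
  have := is_derive1_ln x0 => dln.
  have dV := @is_deriveV K id x 1 1 xn0 (is_derive_id _ _).
  apply: is_derive_eq.
  rewrite /GRing.scale /=; field; exact: xn0.
- by move=> x _; have := sqr_ge0 (1 - x^-1); nra.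
Qed.

(** The midpoint rule, dual to the trapezoidal one, used for the upper Stirling
    bound. *)
Lemma ln_ge_midpoint (K : realType) (w : K) :
  1 <= w -> 2 * (w - 1) / (w + 1) <= ln w.
Proof.
move=> w1; rewrite -subr_ge0.
have -> : ln w - 2 * (w - 1) / (w + 1) = ln w - 2 + 4 * (w + 1)^-1.
  by field; neq0.
apply: (@derivative_ge0 K (fun w => ln w - 2 + 4 * (w + 1)^-1)
          (fun w => w^-1 - 4 * (w + 1)^-1 ^+ 2)) => //.
- by rewrite ln1 (_ : 1 + 1 = 2 :> K); lra.
- move=> x x1; have x0 : 0 < x by lra.
  have xn0 : x + 1 != 0 by neq0.
  have := is_derive1_ln x0 => dln.
  have dV := @is_deriveV K (fun x => x + 1) x _ 1 xn0 _.
  apply: is_derive_eq.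
  rewrite /GRing.scale /=; field; neq0.
- move=> x x1.
  have -> : x^-1 - 4 * (x + 1)^-1 ^+ 2 = (x - 1) ^+ 2 / (x * (x + 1) ^+ 2).
    by field; neq0.
  by rewrite divr_ge0 ?sqr_ge0 // mulr_ge0 ?sqr_ge0; lra.
Qed.

Lemma ln_le_sub1 (K : realType) (x : K) : 0 < x -> ln x <= x - 1.
Proof.
by move=> x0; have := @le_ln1Dx K (x - 1); rewrite subrKC; apply; lra.
Qed.

(** A twelfth power of [exp (1/8) <= 8/7], which comes from [1 - 1/8 <= exp (- 1/8)]. *)
Lemma expR32_le5 (K : realType) : expR (3 / 2) <= 5 :> K.
Proof.
have -> : 3 / 2 = 12%:R * (1 / 8) :> K by lra.
rewrite expRM_natl.
have h : expR (1 / 8) <= 8 / 7 :> K.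
  have h := @expR_ge1Dx K (- (1 / 8)).
  have p := @expR_gt0 K (1 / 8).
  rewrite expRN in h; rewrite -subr_ge0.
  have : 0 <= ((expR (1 / 8))^-1 - 7 / 8) * expR (1 / 8) :> K.
    by apply: mulr_ge0; lra.
  by rewrite mulrBl mulVf ?gt_eqF //; lra.
apply: le_trans (_ : (8 / 7) ^+ 12 <= _); last by lra.
by rewrite lerXn2r ?nnegrE ?expR_ge0 //; lra.
Qed.

(** * Factorials *)

(** Lower Stirling bounds contain the factor [sqrt a], which must be replaced by
    a positive number when [a = 0].  Any number at most [exp (- 3/2)] makes
    [ln_fact_ge] hold at [0], and a large one is best for [padded_ratio_le]. *)
Definition padded (K : realType) (a : nat) : K := if a == 0%N then 5^-1 else a%:R.

Lemma padded_gt0 (K : realType) (a : nat) : 0 < padded K a.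
Proof. by rewrite /padded; case: a => [|a] /=; [lra | rewrite ltr0n]. Qed.

Lemma le_padded (K : realType) (a : nat) : a%:R <= padded K a.
Proof. by rewrite /padded; case: a => [|a] //=; lra. Qed.

Lemma ln_factS (K : realType) (a : nat) :
  ln ((a.+1)`!%:R : K) = ln a.+1%:R + ln a`!%:R.
Proof. by rewrite factS natrM lnM // posrE ltr0n ?fact_gt0. Qed.

(** [a! <= e sqrt a (a / e)^a]: the ratio of the two sides decreases with [a], by
    the midpoint rule. *)
Lemma ln_fact_le (K : realType) (a : nat) : (0 < a)%N ->
  ln (a`!%:R : K) <= 1 + ln a%:R / 2 + a%:R * ln a%:R - a%:R.
Proof.
case: a => // a _; elim: a => [|a IH]; first by rewrite (_ : 1`! = 1)%N // ln1; lra.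
rewrite ln_factS.
have a0 : 0 < a.+1%:R :> K by rewrite ltr0n.
have aS : a.+2%:R = a.+1%:R + 1 :> K by rewrite -natr1.
move: IH aS a0; set u : K := a.+1%:R; set v : K := a.+2%:R => IH aS a0.
have v0 : 0 < v by lra.
have := @ln_ge_midpoint K (v / u); rewrite ler_pdivlMr // mul1r ln_div ?posrE //.
have -> : 2 * (v / u - 1) / (v / u + 1) = 2 / (2 * u + 1).
  by rewrite aS; field; neq0.
rewrite ler_pdivrMr; last lra.
by move=> /(_ ltac:(lra)); rewrite aS in v0 *; nra.
Qed.

(** The trapezoidal rule bounds the error at step [a] by
    [1 / (4 a) - 1 / (4 (a + 1))]; the term [1 / (4 a)] in the statement is what
    makes the induction close. *)
Lemma ln_fact_ge_pos (K : realType) (a : nat) : (0 < a)%N ->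
  3 / 4 + (4 * a%:R)^-1 + ln a%:R / 2 + a%:R * ln a%:R - a%:R
    <= ln (a`!%:R : K).
Proof.
case: a => // a _; elim: a => [|a IH]; first by rewrite (_ : 1`! = 1)%N // ln1; lra.
rewrite ln_factS.
have a0 : 0 < a.+1%:R :> K by rewrite ltr0n.
have aS : a.+2%:R = a.+1%:R + 1 :> K by rewrite -natr1.
move: IH aS a0; set u : K := a.+1%:R; set v : K := a.+2%:R => IH aS a0.
have v0 : 0 < v by lra.
have := @ln_le_trapezoid K (v / u); rewrite ler_pdivlMr // mul1r ln_div ?posrE //.
move=> /(_ ltac:(lra)) h.
have : (u + 1 / 2) * (ln v - ln u) <= 1 + (4 * u)^-1 - (4 * v)^-1.
  apply: le_trans (_ : (u + 1 / 2) * ((v / u - (v / u)^-1) / 2) <= _).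
    by rewrite ler_wpM2l //; lra.
  by_eq; rewrite aS; field; neq0.
have -> : v * ln v = u * ln v + ln v by rewrite aS; ring.
by move=> h2; move: IH h2; rewrite !invfM aS; clearbody u v => IH h2; lra.
Qed.

Lemma ln_fact_ge (K : realType) (a : nat) :
  3 / 4 + ln (padded K a) / 2 + a%:R * ln a%:R - a%:R <= ln (a`!%:R : K).
Proof.
case: a => [|a]; last first.
  apply: le_trans (@ln_fact_ge_pos K a.+1 _) => //.
  have : 0 < (4 * a.+1%:R)^-1 :> K by rewrite invr_gt0 mulr_gt0 ?ltr0n.
  by rewrite /padded /=; move: (_^-1) => i; lra.
rewrite /padded /= fact0 ln1 mul0r lnV ?posrE ?ltr0n //.
have : 3 / 2 <= ln 5 :> K by rewrite -ler_expR lnK ?posrE ?ltr0n // expR32_le5.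
lra.
Qed.

(** * The contribution of one cell to the relative entropy *)

(** The linear terms cancel in a sum over all cells, since observed and expected
    cells have the same total, and make every single term nonnegative. *)
Definition cell {K : realType} (e o : K) : K := o * ln (o / e) - o + e.

Lemma cell0 (K : realType) (e : K) : cell e 0 = e.
Proof. by rewrite /cell mul0r subr0 add0r. Qed.

(** Convexity in [o]: the graph lies above its tangent at [x]. *)
Lemma cell_gradient (K : realType) (e x y : K) : 0 < e -> 0 < x -> 0 <= y ->
  (y - x) * ln (x / e) <= cell e y - cell e x.
Proof.
move=> e0 x0; rewrite le_eqVlt => /predU1P[<-|y0].
  by rewrite cell0 /cell; lra.
rewrite /cell.
have := @ln_le_sub1 K (x / y) (divr_gt0 x0 y0).
rewrite !ln_div ?posrE // => h.
have : y * (ln x - ln y) <= y * (x / y - 1) by rewrite ler_wpM2l // ltW.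
have -> : y * (x / y - 1) = x - y by field; neq0.
lra.
Qed.

Lemma cell_ge0 (K : realType) (e o : K) : 0 < e -> 0 <= o -> 0 <= cell e o.
Proof.
move=> e0 o0; have := @cell_gradient K e e o e0 e0 o0.
by rewrite /cell divff ?gt_eqF // ln1; lra.
Qed.

(** Entropy is at most chi-square. *)
Lemma cell_le (K : realType) (e o : K) : 0 < e -> 0 <= o ->
  cell e o <= (o - e) ^+ 2 / e.
Proof.
move=> e0; rewrite le_eqVlt => /predU1P[<-|o0].
  rewrite cell0; by_eq; field; neq0.
have h := @ln_le_sub1 K (o / e) (divr_gt0 o0 e0).
have {}h : o * ln (o / e) <= o * (o / e - 1) by rewrite ler_wpM2l // ltW.
have -> : (o - e) ^+ 2 / e = o * (o / e - 1) - o + e by field; neq0.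
by rewrite /cell; lra.
Qed.

Lemma cell_ge (K : realType) (e o : K) : 0 < e -> 0 <= o -> o <= e ->
  (e - o) ^+ 2 / (2 * e) <= cell e o.
Proof.
move=> e0; rewrite le_eqVlt => /predU1P[<-|o0] oe.
  rewrite cell0 subr0.
  have -> : e ^+ 2 / (2 * e) = e / 2 by field; neq0.
  lra.
have := @ln_le_trapezoid K (e / o).
rewrite ler_pdivlMr // mul1r ln_div ?posrE // => /(_ oe) h.
have {}h : o * (ln e - ln o) <= o * ((e / o - (e / o)^-1) / 2).
  by rewrite ler_wpM2l // ltW.
rewrite /cell ln_div ?posrE //.
suff -> : (e - o) ^+ 2 / (2 * e) = e - o - o * ((e / o - (e / o)^-1) / 2) by lra.
by field; neq0.
Qed.

(** If [e <= 2 a] the ratio is at most [2]; otherwise the ratio is at most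
    [1 + (e - a)], as [a >= 1], while the cell is at least [(e - a) / 4] by
    [cell_ge].  For [a = 0] the cell is [e] itself. *)
Lemma padded_ratio_le (K : realType) (a : nat) (e : K) : a%:R < e ->
  e / padded K a <= 2 + 5 * cell e a%:R.
Proof.
move=> ae; rewrite ler_pdivrMr ?padded_gt0 //.
case: a ae => [|a] ae; first by rewrite cell0 /padded /=; lra.
rewrite /padded /=.
have a1 : 1 <= a.+1%:R :> K by rewrite ler1n.
move: ae a1; set b : K := a.+1%:R => ae b1.
have e0 : 0 < e by lra.
have c0 := @cell_ge0 K e b e0 ltac:(lra).
have [le|gt] := lerP e (2 * b); first by nra.
have := @cell_ge K e b e0 ltac:(lra) ltac:(lra).
rewrite ler_pdivrMr; last lra.
move=> h.
have {}h : (e - b) / 4 <= cell e b.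
  rewrite -subr_ge0; set c := cell e b in h *.
  have : 0 <= (c - (e - b) / 4) * (2 * e) by nra.
  by rewrite pmulr_lge0 //; lra.
nra.
Qed.

(** * The rate function *)

Definition hyper_mean (K : realType) (N n R : nat) : K := n%:R * R%:R / N%:R.

(** Both [(n - m) (R - m) / N] and the inverse of the sum of the inverses of the
    expected cells. *)
Definition hyper_var (K : realType) (N n R : nat) : K :=
  n%:R * R%:R * (N%:R - n%:R) * (N%:R - R%:R) / N%:R ^+ 3.

Definition proper_margins (N n R : nat) : bool :=
  (0 < n < N)%N && (0 < R < N)%N.

(** All four observed cells are nonnegative. *)
Definition in_range {K : realType} (N n R : nat) (x : K) : bool :=
  [&& 0 <= x, x <= n%:R, x <= R%:R & 0 <= N%:R - n%:R - R%:R + x].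

Lemma proper_margins_real (K : realType) (N n R : nat) : proper_margins N n R ->
  [/\ 0 < n%:R :> K, 0 < R%:R :> K, n%:R < N%:R :> K & R%:R < N%:R :> K].
Proof. by rewrite /proper_margins !ltr_nat !ltr0n => /andP[/andP[-> ->] /andP[-> ->]]. Qed.

Lemma expected_cells (K : realType) (N n R : nat) : proper_margins N n R ->
  let m := hyper_mean K N n R in
  [/\ 0 < m, n%:R - m = n%:R * (N%:R - R%:R) / N%:R,
      R%:R - m = (N%:R - n%:R) * R%:R / N%:R &
      N%:R - n%:R - R%:R + m = (N%:R - n%:R) * (N%:R - R%:R) / N%:R].
Proof.
move=> /(@proper_margins_real K)[n0 R0 nN RN] /=; rewrite /hyper_mean.
move: (n%:R) (R%:R) (N%:R) n0 R0 nN RN => n' R' N' n0 R0 nN RN.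
split; [by rewrite divr_gt0 ?mulr_gt0 //; lra| | |]; by field; neq0.
Qed.

Lemma expected_cells_gt0 (K : realType) (N n R : nat) : proper_margins N n R ->
  let m := hyper_mean K N n R in
  [/\ 0 < m, 0 < n%:R - m, 0 < R%:R - m & 0 < N%:R - n%:R - R%:R + m].
Proof.
move=> pm /=; have [m0 -> -> ->] := @expected_cells K _ _ _ pm.
have [n0 R0 nN RN] := @proper_margins_real K _ _ _ pm.
split=> //; by rewrite divr_gt0 ?mulr_gt0 //; lra.
Qed.

Lemma hyper_var_gt0 (K : realType) (N n R : nat) : proper_margins N n R ->
  0 < hyper_var K N n R.
Proof.
move=> pm; have [n0 R0 nN RN] := @proper_margins_real K _ _ _ pm.
by rewrite /hyper_var divr_gt0 ?exprn_gt0 ?mulr_gt0 //; lra.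
Qed.

Lemma hyper_LE (K : realType) (N n R : nat) (x : K) : proper_margins N n R ->
  let m := hyper_mean K N n R in
  hyper_L N n R x = cell m x + cell (n%:R - m) (n%:R - x)
    + cell (R%:R - m) (R%:R - x)
    + cell (N%:R - n%:R - R%:R + m) (N%:R - n%:R - R%:R + x).
Proof.
move=> pm /=; have [m0 e2 e3 e4] := @expected_cells K _ _ _ pm.
have [n0 R0 nN RN] := @proper_margins_real K _ _ _ pm.
rewrite /cell /hyper_L /bernoulli_divergence.
rewrite e2 e3 e4.
have -> : x / n%:R / (R%:R / N%:R) = x / hyper_mean K N n R.
  by rewrite /hyper_mean; field; neq0.
have -> : (1 - x / n%:R) / (1 - R%:R / N%:R)
    = (n%:R - x) / (n%:R * (N%:R - R%:R) / N%:R).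
  by field; neq0.
have -> : (R%:R - x) / (N%:R - n%:R) / (R%:R / N%:R)
    = (R%:R - x) / ((N%:R - n%:R) * R%:R / N%:R).
  by field; neq0.
have -> : (1 - (R%:R - x) / (N%:R - n%:R)) / (1 - R%:R / N%:R)
    = (N%:R - n%:R - R%:R + x) / ((N%:R - n%:R) * (N%:R - R%:R) / N%:R).
  by field; neq0.
move: (ln _) (ln _) (ln _) (ln _) => l1 l2 l3 l4.
by rewrite /hyper_mean; field; neq0.
Qed.

(** The determinant of the 2 x 2 table of observed cells. *)
Lemma cross_difference (K : realType) (N n R : nat) (x : K) :
  proper_margins N n R ->
  x * (N%:R - n%:R - R%:R + x)
    = (n%:R - x) * (R%:R - x) + N%:R * (x - hyper_mean K N n R).
Proof.
move=> pm; have [n0 R0 nN RN] := @proper_margins_real K _ _ _ pm.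
by rewrite /hyper_mean; field; neq0.
Qed.

Lemma expected_product (K : realType) (N n R : nat) :
  proper_margins N n R -> let m := hyper_mean K N n R in
  (n%:R - m) * (R%:R - m) = N%:R * hyper_var K N n R.
Proof.
move=> pm /=; have [n0 R0 nN RN] := @proper_margins_real K _ _ _ pm.
by rewrite /hyper_mean /hyper_var; field; neq0.
Qed.

Lemma hyper_L_le (K : realType) (N n R : nat) (x : K) :
  proper_margins N n R -> in_range N n R x ->
  hyper_L N n R x <= (x - hyper_mean K N n R) ^+ 2 / hyper_var K N n R.
Proof.
move=> pm /and4P[x1 x2 x3 x4]; rewrite (@hyper_LE K _ _ _ _ pm).
have [n0 R0 nN RN] := @proper_margins_real K _ _ _ pm.
have [m1 m2 m3 m4] := @expected_cells_gt0 K _ _ _ pm.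
set m := hyper_mean K N n R in m1 m2 m3 m4 *.
have c1 := @cell_le K _ _ m1 x1.
have c2 := @cell_le K _ (n%:R - x) m2 ltac:(lra).
have c3 := @cell_le K _ (R%:R - x) m3 ltac:(lra).
have c4 := @cell_le K _ (N%:R - n%:R - R%:R + x) m4 ltac:(lra).
have -> : (x - m) ^+ 2 / hyper_var K N n R
   = (x - m) ^+ 2 / m + (n%:R - x - (n%:R - m)) ^+ 2 / (n%:R - m)
     + (R%:R - x - (R%:R - m)) ^+ 2 / (R%:R - m)
     + (N%:R - n%:R - R%:R + x - (N%:R - n%:R - R%:R + m)) ^+ 2
         / (N%:R - n%:R - R%:R + m).
  have [_ -> -> ->] := @expected_cells K _ _ _ pm.
  by rewrite /m /hyper_mean /hyper_var; field; neq0.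
by rewrite !lerD.
Qed.

Lemma hyper_L_ge (K : realType) (N n R : nat) (x : K) :
  proper_margins N n R -> in_range N n R x -> let m := hyper_mean K N n R in
  cell (n%:R - m) (n%:R - x) + cell (R%:R - m) (R%:R - x) <= hyper_L N n R x.
Proof.
move=> pm /and4P[x1 x2 x3 x4] /=; rewrite (@hyper_LE K _ _ _ _ pm).
have [m1 m2 m3 m4] := @expected_cells_gt0 K _ _ _ pm.
set m := hyper_mean K N n R in m1 m2 m3 m4 *.
have c1 := @cell_ge0 K _ _ m1 x1.
have c4 := @cell_ge0 K _ (N%:R - n%:R - R%:R + x) m4 ltac:(lra).
by lra.
Qed.

Lemma hyper_L_ge0 (K : realType) (N n R : nat) (x : K) :
  proper_margins N n R -> in_range N n R x -> 0 <= hyper_L N n R x.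
Proof.
move=> pm xr; apply: le_trans (@hyper_L_ge K _ _ _ _ pm xr).
have [m1 m2 m3 m4] := @expected_cells_gt0 K _ _ _ pm.
by move/and4P: xr => [x1 x2 x3 x4]; rewrite addr_ge0 // cell_ge0 //; lra.
Qed.

(** The exponential of the derivative of the rate function. *)
Definition odds_ratio {K : realType} (N n R : nat) (x : K) : K :=
  x * (N%:R - n%:R - R%:R + x) / ((n%:R - x) * (R%:R - x)).

(** Sum of the tangent inequalities of the four cells; the expected cells
    disappear from the slope because their own odds ratio is [1]. *)
Lemma hyper_L_gradient (K : realType) (N n R : nat) (x y : K) :
  proper_margins N n R -> 0 < x -> x < n%:R -> x < R%:R ->
  0 < N%:R - n%:R - R%:R + x -> in_range N n R y ->
  (y - x) * ln (odds_ratio N n R x) <= hyper_L N n R y - hyper_L N n R x.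
Proof.
move=> pm x1 x2 x3 x4 /and4P[y1 y2 y3 y4]; rewrite !(fun z => @hyper_LE K _ _ _ z pm).
have [m1 m2 m3 m4] := @expected_cells_gt0 K _ _ _ pm.
have eprod : hyper_mean K N n R * (N%:R - n%:R - R%:R + hyper_mean K N n R)
    = (n%:R - hyper_mean K N n R) * (R%:R - hyper_mean K N n R).
  by rewrite (@cross_difference K _ _ _ _ pm) subrr mulr0 addr0.
set m := hyper_mean K N n R in m1 m2 m3 m4 eprod *.
clearbody m.
have a2 : 0 < n%:R - x by lra.
have a3 : 0 < R%:R - x by lra.
have {}eprod : ln m + ln (N%:R - n%:R - R%:R + m) = ln (n%:R - m) + ln (R%:R - m).
  by rewrite -!lnM ?posrE // eprod.
have c1 := @cell_gradient K _ _ _ m1 x1 y1.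
have c2 := @cell_gradient K _ _ (n%:R - y) m2 a2 ltac:(lra).
have c3 := @cell_gradient K _ _ (R%:R - y) m3 a3 ltac:(lra).
have c4 := @cell_gradient K _ _ (N%:R - n%:R - R%:R + y) m4 x4 ltac:(lra).
rewrite !ln_div ?posrE // in c1 c2 c3 c4.
rewrite /odds_ratio ln_div ?posrE ?mulr_gt0 // !lnM ?posrE //.
have {}c2 : - (y - x) * (ln (n%:R - x) - ln (n%:R - m))
    <= cell (n%:R - m) (n%:R - y) - cell (n%:R - m) (n%:R - x).
  by apply: le_trans c2; by_eq; ring.
have {}c3 : - (y - x) * (ln (R%:R - x) - ln (R%:R - m))
    <= cell (R%:R - m) (R%:R - y) - cell (R%:R - m) (R%:R - x).
  by apply: le_trans c3; by_eq; ring.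
have {}c4 : (y - x) * (ln (N%:R - n%:R - R%:R + x) - ln (N%:R - n%:R - R%:R + m))
    <= cell (N%:R - n%:R - R%:R + m) (N%:R - n%:R - R%:R + y)
       - cell (N%:R - n%:R - R%:R + m) (N%:R - n%:R - R%:R + x).
  by apply: le_trans c4; by_eq; ring.
have {eprod} : (y - x) * (ln m + ln (N%:R - n%:R - R%:R + m))
   = (y - x) * (ln (n%:R - m) + ln (R%:R - m)) by rewrite eprod.
move=> e; lra.
Qed.

Lemma odds_ratio_ge1 (K : realType) (N n R : nat) (x : K) :
  proper_margins N n R -> hyper_mean K N n R <= x -> x < n%:R -> x < R%:R ->
  1 <= odds_ratio N n R x.
Proof.
move=> pm mx xn xR; rewrite /odds_ratio ler_pdivlMr ?mulr_gt0 ?subr_gt0 //.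
have [n0 R0 nN RN] := @proper_margins_real K _ _ _ pm.
rewrite mul1r (@cross_difference K _ _ _ _ pm) lerDl mulr_ge0 //; lra.
Qed.

Lemma hyper_L_homo (K : realType) (N n R : nat) (x y : K) :
  proper_margins N n R -> hyper_mean K N n R <= x -> x <= y ->
  in_range N n R y -> hyper_L N n R x <= hyper_L N n R y.
Proof.
move=> pm mx; rewrite le_eqVlt => /predU1P[-> //|xy yr].
have [m1 m2 m3 m4] := @expected_cells_gt0 K _ _ _ pm.
have /and4P[y1 y2 y3 y4] := yr.
rewrite -subr_ge0; apply: le_trans (@hyper_L_gradient K _ _ _ _ _ pm _ _ _ _ yr).
- rewrite mulr_ge0 ?subr_ge0 ?(ltW xy) // ln_ge0 // odds_ratio_ge1 //; lra.
- lra.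
- lra.
- lra.
- lra.
Qed.

(** * Stirling's bound on the point probabilities *)

Definition hyper_pmf (K : realType) (N n R j : nat) : K :=
  ('C(R, j) * 'C(N - R, n - j))%:R / 'C(N, n)%:R.

Lemma ln_bin (K : realType) (a b : nat) : (b <= a)%N ->
  ln ('C(a, b)%:R : K) = ln a`!%:R - ln b`!%:R - ln (a - b)`!%:R.
Proof.
move=> ba; rewrite -(bin_fact ba) !natrM !lnM ?posrE ?mulr_gt0 ?ltr0n ?fact_gt0 ?bin_gt0 //.
lra.
Qed.

Lemma mul_ln_div (K : realType) (o e : K) : 0 < e -> 0 <= o ->
  o * ln (o / e) = o * ln o - o * ln e.
Proof.
move=> e0; rewrite le_eqVlt => /predU1P[<-|o0]; first by rewrite !mul0r subrr.
by rewrite ln_div ?posrE // mulrBr.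
Qed.

(** The form in which the rate function matches the main terms of Stirling's
    formula for the nine factorials of a point probability. *)
Lemma hyper_L_entropyE (K : realType) (N n R : nat) (x : K) :
  proper_margins N n R -> in_range N n R x ->
  let phi (t : K) := t * ln t in
  hyper_L N n R x
    = phi x + phi (n%:R - x) + phi (R%:R - x) + phi (N%:R - n%:R - R%:R + x)
      - phi n%:R - phi (N%:R - n%:R) - phi R%:R - phi (N%:R - R%:R) + phi N%:R.
Proof.
move=> pm /and4P[x1 x2 x3 x4] /=; rewrite (@hyper_LE K _ _ _ _ pm).
have [m1 m2 m3 m4] := @expected_cells_gt0 K _ _ _ pm.
have [_ e2 e3 e4] := @expected_cells K _ _ _ pm.
have [n0 R0 nN RN] := @proper_margins_real K _ _ _ pm.
rewrite /cell !mul_ln_div //; try lra.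
rewrite e2 e3 e4 /hyper_mean.
have Nn : 0 < N%:R - n%:R :> K by lra.
have NR : 0 < N%:R - R%:R :> K by lra.
have N0 : 0 < N%:R :> K by lra.
rewrite !ln_div ?posrE ?mulr_gt0 // !lnM ?posrE //.
by field; neq0.
Qed.

Lemma natr_cells (K : realType) (N n R j : nat) : proper_margins N n R ->
  (j <= n)%N -> (j <= R)%N -> (n - j <= N - R)%N ->
  [/\ (n - j)%:R = n%:R - j%:R :> K, (R - j)%:R = R%:R - j%:R :> K,
      (N - R - (n - j))%:R = N%:R - n%:R - R%:R + j%:R :> K &
      in_range N n R (j%:R : K)].
Proof.
move=> /andP[_ /andP[_ RN]] jn jR nj.
have castA : (n - j)%:R = n%:R - j%:R :> K by rewrite natrB.
have castB : (R - j)%:R = R%:R - j%:R :> K by rewrite natrB.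
have castW : (N - R - (n - j))%:R = N%:R - n%:R - R%:R + j%:R :> K.
  by rewrite natrB // castA natrB ?(ltnW RN) //; ring.
by split=> //; rewrite /in_range -castW -[j%:R <= n%:R]subr_ge0
  -[j%:R <= R%:R]subr_ge0 -castA -castB !ler0n.
Qed.

(** Four factorials in the numerator, each costing [1], against five in the
    denominator, each gaining [3/4], leave the constant [4 - 15/4 = 1/4]. *)
Lemma hyper_pmf_ln_le (K : realType) (N n R j : nat) : proper_margins N n R ->
  (j <= n)%N -> (j <= R)%N -> (n - j <= N - R)%N ->
  ln (hyper_pmf K N n R j) <= 4^-1 + (ln n%:R + ln (N%:R - n%:R) + ln R%:R
     + ln (N%:R - R%:R) - ln N%:R - ln (padded K j) - ln (padded K (n - j))
     - ln (padded K (R - j)) - ln (padded K (N - R - (n - j)))) / 2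
   - hyper_L N n R j%:R.
Proof.
move=> pm jn jR nj.
have [/andP[n0 nN] /andP[R0 RN]] := andP pm.
have [n0' R0' nN' RN'] := @proper_margins_real K _ _ _ pm.
have Nn0 : (0 < N - n)%N by rewrite subn_gt0.
have NR0 : (0 < N - R)%N by rewrite subn_gt0.
have [castA castB castW jr] := @natr_cells K _ _ _ _ pm jn jR nj.
have castn : (N - n)%:R = N%:R - n%:R :> K by rewrite natrB // ltnW.
have castR : (N - R)%:R = N%:R - R%:R :> K by rewrite natrB // ltnW.
rewrite (@hyper_L_entropyE K _ _ _ _ pm jr).
rewrite /hyper_pmf natrM ln_div ?posrE ?mulr_gt0 ?ltr0n ?bin_gt0 ?(ltnW nN) //.
rewrite lnM ?posrE ?ltr0n ?bin_gt0 // !ln_bin // ?(ltnW nN) //.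
have := @ln_fact_ge K j; have := @ln_fact_ge K (n - j).
have := @ln_fact_ge K (R - j); have := @ln_fact_ge K (N - R - (n - j)).
have := @ln_fact_ge K N.
have := @ln_fact_le K n n0; have := @ln_fact_le K R R0.
have := @ln_fact_le K (N - n) Nn0; have := @ln_fact_le K (N - R) NR0.
have -> : padded K N = N%:R by rewrite /padded; case: eqP => // N0; rewrite N0 in nN.
rewrite castA castB castW castn castR.
move: (ln n`!%:R) (ln R`!%:R) (ln (N - n)`!%:R) (ln (N - R)`!%:R) (ln N`!%:R)
  (ln j`!%:R) (ln (n - j)`!%:R) (ln (R - j)`!%:R) (ln (N - R - (n - j))`!%:R).
move: (ln (padded K j)) (ln (padded K (n - j))) (ln (padded K (R - j)))
  (ln (padded K (N - R - (n - j)))).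
move: (n%:R) (j%:R) (R%:R) (N%:R) => n' j' R' N'.
move=> p1 p2 p3 p4 f1 f2 f3 f4 f5 f6 f7 f8 f9 h1 h2 h3 h4 h5 h6 h7 h8 h9.
lra.
Qed.

Lemma hyper_pmf_gt0 (K : realType) (N n R j : nat) : proper_margins N n R ->
  (j <= n)%N -> (j <= R)%N -> (n - j <= N - R)%N -> 0 < hyper_pmf K N n R j.
Proof.
move=> /andP[/andP[_ nN] _] jn jR nj.
by rewrite /hyper_pmf divr_gt0 ?ltr0n ?muln_gt0 ?bin_gt0 ?jR ?nj // ltnW.
Qed.

Lemma hyper_pmf_sqr_le (K : realType) (N n R j : nat) : proper_margins N n R ->
  (j <= n)%N -> (j <= R)%N -> (n - j <= N - R)%N ->
  (hyper_pmf K N n R j * expR (hyper_L N n R j%:R)) ^+ 2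
    <= expR (1 / 2) * (hyper_var K N n R * N%:R ^+ 2)
       / (padded K j * padded K (n - j)
          * (padded K (R - j) * padded K (N - R - (n - j)))).
Proof.
move=> pm jn jR nj.
have h0 := @hyper_pmf_gt0 K _ _ _ _ pm jn jR nj.
have := @hyper_pmf_ln_le K _ _ _ _ pm jn jR nj.
have [n0 R0 nN RN] := @proper_margins_real K _ _ _ pm.
have Nn : 0 < N%:R - n%:R :> K by lra.
have NR : 0 < N%:R - R%:R :> K by lra.
have N0 : 0 < N%:R :> K by lra.
have p1 := @padded_gt0 K j; have p2 := @padded_gt0 K (n - j).
have p3 := @padded_gt0 K (R - j); have p4 := @padded_gt0 K (N - R - (n - j)).
have v0 : hyper_var K N n R * N%:R ^+ 2
    = n%:R * (N%:R - n%:R) * (R%:R * (N%:R - R%:R)) / N%:R.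
  by rewrite /hyper_var; field; neq0.
rewrite v0.
move: (hyper_pmf _ _ _ _ _) h0 (padded K j) p1 (padded K (n - j)) p2
  (padded K (R - j)) p3 (padded K (N - R - (n - j))) p4 => h h0 a a0 b b0 c c0 d d0.
move=> hle.
rewrite -ler_ln ?posrE ?exprn_gt0 ?divr_gt0 ?mulr_gt0 ?expR_gt0 ?divr_gt0 ?mulr_gt0 //.
rewrite lnXn ?mulr_gt0 ?expR_gt0 // !ln_div ?posrE ?mulr_gt0 ?expR_gt0 ?divr_gt0 ?mulr_gt0 //.
rewrite !lnM ?posrE ?mulr_gt0 ?expR_gt0 ?divr_gt0 ?mulr_gt0 ?invr_gt0 //.
rewrite lnV ?posrE // !expRK mulr2n.
1: lra.
all: by rewrite invr_gt0.
Qed.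

(** * Comparison of a point probability with a decrement of the bound *)

Lemma expR12_le (K : realType) : expR (1 / 2) <= 16 / 9 :> K.
Proof.
have := @expR32_le5 K.
have -> : 3 / 2 = 3%:R * (1 / 2) :> K by lra.
rewrite expRM_natl; set e := expR _ => h.
have : 0 < e by exact: expR_gt0.
move: h; clearbody e => h e0; rewrite leNgt; apply/negP => gt.
have : (16 / 9) ^+ 3 < e ^+ 3 by rewrite ltrXn2r ?nnegrE //; lra.
lra.
Qed.

(** The exponent in the square of the constant is exactly [13 / (6 s)]. *)
Lemma hyper_CE_ge (K : realType) (N n R : nat) : proper_margins N n R ->
  4 + 26 / 3 / hyper_var K N n R <= hyper_C K N n R ^+ 2.
Proof.
move=> pm; have [n0 R0 nN RN] := @proper_margins_real K _ _ _ pm.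
rewrite /hyper_C exprMn -expRM_natl.
set t := 2%:R * _.
have -> : 26 / 3 / hyper_var K N n R = 4 * t.
  by rewrite /t /hyper_var; field; neq0.
by have := @expR_ge1Dx K t; lra.
Qed.

Lemma hyper_C_ge2 (K : realType) (N n R : nat) : proper_margins N n R ->
  2 <= hyper_C K N n R.
Proof.
move=> pm; have := @hyper_CE_ge K _ _ _ pm.
have v0 := @hyper_var_gt0 K _ _ _ pm.
have iv : 0 < 26 / 3 / hyper_var K N n R by rewrite divr_gt0 //; lra.
have C0 : 0 < hyper_C K N n R by rewrite /hyper_C mulr_gt0 ?expR_gt0.
move=> h; rewrite -ler_sqr ?nnegrE; lra.
Qed.

(** After division by [T], and with [d^2 / s >= 3/2], the claim reduces to
    [(100/9) d <= (4 - 128/675) d^2 + 13], whose discriminant is negative. *)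
Lemma key_polynomial (K : realType) (k s d T c : K) :
  k <= 16 / 9 -> 0 < s -> 0 < d -> 25 / 4 <= T -> 3 / 2 * s <= d ^+ 2 ->
  4 + 26 / 3 / s <= c ->
  k * (s + 25 / 4 * d * T) <= c * T * d ^+ 2.
Proof.
move=> k1 s0 d0 T1 sd hc.
have sV : 3 / 2 <= d ^+ 2 / s by rewrite ler_pdivlMr.
have h1 : k * (s + 25 / 4 * d * T) <= 16 / 9 * (s + 25 / 4 * d * T).
  by rewrite ler_wpM2r //; nra.
apply: (le_trans h1).
have h2 : (4 * d ^+ 2 + 13) * T <= c * T * d ^+ 2.
  have : (4 + 26 / 3 / s) * (T * d ^+ 2) <= c * (T * d ^+ 2).
    by rewrite ler_wpM2r // mulr_ge0 ?sqr_ge0 //; lra.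
  have -> : (4 + 26 / 3 / s) * (T * d ^+ 2)
     = (4 * d ^+ 2 + 26 / 3 * (d ^+ 2 / s)) * T by field; neq0.
  rewrite mulrA; apply: le_trans.
  by rewrite ler_wpM2r //; lra.
apply: le_trans h2.
have h3 : s <= (2 / 3 * d ^+ 2) * (4 / 25 * T).
  apply: le_trans (_ : (2 / 3 * d ^+ 2) * 1 <= _); first lra.
  by rewrite ler_wpM2l //; have := sqr_ge0 d; lra.
apply: le_trans (_ : (16 / 9 * (2 / 3 * d ^+ 2 * (4 / 25) + 25 / 4 * d)) * T <= _).
  by nra.
rewrite ler_wpM2r //; first lra.
(* 100/27 times this square is at most the right side minus the left side *)
have := sqr_ge0 (d - 3 / 2); nra.
Qed.

(** The analytic core, with one name for each quantity: [A] and [B] are the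
    observed cells below their expectations [eA] and [eB], [A'] and [B'] their
    padded versions, [LA] and [LB] their shares of [L], [d] is the distance from
    the mean [x - m], and [H] stands for [h x exp (L x)]. *)
Lemma key_comparison (K : realType)
    (k s d L C x W N A B A' B' eA eB LA LB H : K) :
  0 <= k -> k <= 16 / 9 -> 0 < s -> 0 < d -> 0 < x -> 0 < W -> 0 < N -> 0 < C ->
  0 <= H ->
  0 <= A -> A <= A' -> 0 < A' -> 0 <= B -> B <= B' -> 0 < B' ->
  0 < eA -> 0 < eB -> eA / A' <= 2 + 5 * LA -> eB / B' <= 2 + 5 * LB ->
  0 <= LA -> 0 <= LB -> LA + LB <= L -> 3 / 2 <= L -> L <= d ^+ 2 / s ->
  eA * eB = N * s -> x * W = A * B + N * d ->
  4 + 26 / 3 / s <= C ^+ 2 ->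
  H ^+ 2 <= k * (s * N ^+ 2) / (x * A' * (B' * W)) ->
  H <= C * (L + 1) * (N * d / (x * W)).
Proof.
move=> k0 k1 s0 d0 x0 W0 N0 C0 H0 A0 lepA pA B0 lepB pB eA0 eB0
  ratA ratB cA cB LAB L2 Lvar eprod cross hC hsq.
have rat : eA * eB <= A' * B' * (25 / 4 * (L + 1) ^+ 2).
  have : (eA / A') * (eB / B') <= (2 + 5 * LA) * (2 + 5 * LB).
    by apply: ler_pM ratA ratB; apply: divr_ge0; apply: ltW.
  have : (2 + 5 * LA) * (2 + 5 * LB) <= 25 / 4 * (L + 1) ^+ 2.
    apply: le_trans (_ : (5 / 2 * (LA + LB + 1)) ^+ 2 <= _).
      by have := sqr_ge0 (LA - LB); nra.
    have -> : 25 / 4 * (L + 1) ^+ 2 = (5 / 2 * (L + 1)) ^+ 2 by field.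
    by rewrite lerXn2r ?nnegrE //; lra.
  move=> h1 h2; move: (le_trans h2 h1).
  by rewrite mulf_div ler_pdivrMr ?mulr_gt0 // [X in _ <= X]mulrC.
have poly : k * (s + 25 / 4 * d * (L + 1) ^+ 2) <= C ^+ 2 * (L + 1) ^+ 2 * d ^+ 2.
  apply: key_polynomial => //; first by nra.
  by move: Lvar; rewrite ler_pdivlMr // => /(le_trans _); apply; nra.
have numer : s * (x * W) <= A' * B' * (s + 25 / 4 * d * (L + 1) ^+ 2).
  rewrite cross.
  have -> : s * (A * B + N * d) = s * (A * B) + d * (N * s) by ring.
  rewrite -eprod.
  have h1 : A * B <= A' * B' by rewrite ler_pM.
  have := ler_wpM2l (ltW s0) h1; have := ler_wpM2l (ltW d0) rat; lra.
have xW0 : 0 < x * W by rewrite mulr_gt0.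
have G0 : 0 <= C * (L + 1) * (N * d / (x * W)).
  by rewrite mulr_ge0 ?divr_ge0 ?mulr_ge0 ?ltW // ltr_wpDl //; lra.
(* square both sides, then cancel the common factor (N / (x W))^2 *)
rewrite -ler_sqr ?nnegrE //; apply: (le_trans hsq).
have -> : (C * (L + 1) * (N * d / (x * W))) ^+ 2
    = (C ^+ 2 * (L + 1) ^+ 2 * d ^+ 2) * (N ^+ 2 / (x * W) ^+ 2).
  by field; neq0.
have -> : k * (s * N ^+ 2) / (x * A' * (B' * W))
  = (k * (s * (x * W))) / (A' * B') * (N ^+ 2 / (x * W) ^+ 2).
  by field; neq0.
rewrite ler_wpM2r ?divr_ge0 ?sqr_ge0 // ler_pdivrMr ?mulr_gt0 //.
have h := ler_wpM2l k0 numer; apply: (le_trans h).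
rewrite mulrCA mulrC; apply: ler_wpM2r => //.
by rewrite mulr_ge0 // ltW.
Qed.

(** The last factor is [1 - 1 / rho], written so that it makes sense (and equals
    [1]) at the end of the range, where the odds ratio [rho] is infinite. *)
Lemma hyper_pmf_le (K : realType) (N n R j : nat) :
  let L := hyper_L N n R (j%:R : K) in
  proper_margins N n R -> (j <= n)%N -> (j <= R)%N -> (n - j <= N - R)%N ->
  hyper_mean K N n R < j%:R -> 3 / 2 <= L ->
  hyper_pmf K N n R j * expR L <= hyper_C K N n R * (L + 1) *
    (N%:R * (j%:R - hyper_mean K N n R) / (j%:R * (N%:R - n%:R - R%:R + j%:R))).
Proof.
move=> L pm jn jR nj mj L2.
have h0 := @hyper_pmf_gt0 K _ _ _ _ pm jn jR nj.
have hsq := @hyper_pmf_sqr_le K _ _ _ _ pm jn jR nj.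
have [n0 R0 nN RN] := @proper_margins_real K _ _ _ pm.
have [m1 m2 m3 m4] := @expected_cells_gt0 K _ _ _ pm.
have [castA castB castW jr] := @natr_cells K _ _ _ _ pm jn jR nj.
have LAB := @hyper_L_ge K _ _ _ _ pm jr.
have Lvar := @hyper_L_le K _ _ _ _ pm jr.
have s0 := @hyper_var_gt0 K _ _ _ pm.
have cross := @cross_difference K N n R j%:R pm.
have eprod := @expected_product K N n R pm.
have hC := @hyper_CE_ge K _ _ _ pm.
have C0 : 0 < hyper_C K N n R by rewrite /hyper_C mulr_gt0 ?expR_gt0.
have ratA := @padded_ratio_le K (n - j) (n%:R - hyper_mean K N n R).
have ratB := @padded_ratio_le K (R - j) (R%:R - hyper_mean K N n R).
rewrite castA in ratA; rewrite castB in ratB.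
have {}ratA := ratA ltac:(lra); have {}ratB := ratB ltac:(lra).
have cA := @cell_ge0 K (n%:R - hyper_mean K N n R) (n%:R - j%:R) m2
  ltac:(rewrite -castA; exact: ler0n).
have cB := @cell_ge0 K (R%:R - hyper_mean K N n R) (R%:R - j%:R) m3
  ltac:(rewrite -castB; exact: ler0n).
have lepA := @le_padded K (n - j); have lepB := @le_padded K (R - j).
rewrite castA in lepA; rewrite castB in lepB.
have pA := @padded_gt0 K (n - j); have pB := @padded_gt0 K (R - j).
have k1 := @expR12_le K.
have W0 : 0 < N%:R - n%:R - R%:R + j%:R :> K by lra.
have j0 : 0 < j%:R :> K by lra.
have padj : padded K j = j%:R.
  by move: j0; rewrite /padded ltr0n; case: (j).
have padW : padded K (N - R - (n - j)) = N%:R - n%:R - R%:R + j%:R.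
  by rewrite -castW; move: W0; rewrite -castW /padded ltr0n; case: (_ - _)%N.
have A0 : 0 <= n%:R - j%:R :> K by rewrite -castA ler0n.
have B0 : 0 <= R%:R - j%:R :> K by rewrite -castB ler0n.
rewrite padj padW in hsq.
have H0 : 0 <= hyper_pmf K N n R j * expR L by rewrite mulr_ge0 ?expR_ge0 // ltW.
apply: (@key_comparison K (expR (1 / 2)) (hyper_var K N n R) _ _ _ _ _ _
  (n%:R - j%:R) (R%:R - j%:R) (padded K (n - j)) (padded K (R - j))
  (n%:R - hyper_mean K N n R) (R%:R - hyper_mean K N n R) _ _ _
  _ _ _ _ _ _ _ _ _ _ _ _ _ _ _ _ _ ratA ratB cA cB LAB L2 Lvar eprod cross hC hsq) => //.
- lra.
- lra.
Qed.

(** * Telescoping the upper tail *)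

Definition tail_bound {K : realType} (t : K) : K := (t + 2) * expR (- t).

(** The derivative of [- tail_bound] at [t] is [(t + 1) exp (- t)]; the remaining
    slack is [exp (- t) (1 - (1 + d) exp (- d)) >= 0]. *)
Lemma tail_bound_drop (K : realType) (t u d : K) : 0 <= t -> 0 <= d ->
  t + d <= u -> (t + 1) * (1 - expR (- d)) * expR (- t) <= tail_bound t - tail_bound u.
Proof.
move=> t0 d0; rewrite -lerBrDl => du.
have -> : u = t + (u - t) by ring.
move: (u - t) du => e de.
have ed : expR (- e) <= expR (- d) by rewrite ler_expR; lra.
have e1 : (1 + e) * expR (- e) <= 1.
  apply: le_trans (_ : expR e * expR (- e) <= 1).
    by rewrite ler_wpM2r ?expR_ge0 // expR_ge1Dx.
  by rewrite -expRD subrr expR0.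
rewrite /tail_bound opprD expRD.
have -> : (t + 2) * expR (- t) - (t + e + 2) * (expR (- t) * expR (- e))
  = (t + 2 - (t + e + 2) * expR (- e)) * expR (- t) by ring.
by rewrite ler_wpM2r ?expR_ge0 //; nra.
Qed.

Lemma tail_bound_nincr (K : realType) (t u : K) : 0 <= t -> t <= u ->
  tail_bound u <= tail_bound t.
Proof.
move=> t0 tu; have := @tail_bound_drop K t u 0 t0 (lexx _).
by rewrite addr0 oppr0 expR0 subrr mulr0 mul0r subr_ge0; apply.
Qed.

Lemma tail_bound_small (K : realType) (t : K) : 0 <= t -> t <= 3 / 2 ->
  1 <= 2 * tail_bound t.
Proof.
move=> t0 t1; apply: le_trans (_ : 2 * tail_bound (3 / 2) <= _); last first.
  by rewrite ler_wpM2l // tail_bound_nincr.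
rewrite /tail_bound expRN mulrA ler_pdivlMr ?expR_gt0 //.
by have := expR32_le5 K; lra.
Qed.

(** [tail_bound_drop] with [d := ln rho], the slope of the rate function at [j],
    so that [1 - exp (- d)] is the factor [1 - 1 / rho] of [hyper_pmf_le]. *)
Lemma hyper_pmf_telescope (K : realType) (N n R j : nat) :
  let L (i : nat) := hyper_L N n R (i%:R : K) in
  proper_margins N n R -> (j < n)%N -> (j < R)%N -> (n - j <= N - R)%N ->
  hyper_mean K N n R < j%:R -> 3 / 2 <= L j ->
  hyper_pmf K N n R j
    <= hyper_C K N n R * (tail_bound (L j) - tail_bound (L j.+1)).
Proof.
move=> L pm jn jR nj mj L2.
have [n0 R0 nN RN] := @proper_margins_real K _ _ _ pm.
have [m1 m2 m3 m4] := @expected_cells_gt0 K _ _ _ pm.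
have C0 : 0 < hyper_C K N n R by rewrite /hyper_C mulr_gt0 ?expR_gt0.
have hH := @hyper_pmf_le K _ _ _ _ pm (ltnW jn) (ltnW jR) nj mj L2.
have jn' : j.+1%:R <= n%:R :> K by rewrite ler_nat.
have jR' : j.+1%:R <= R%:R :> K by rewrite ler_nat.
have jS : j.+1%:R = j%:R + 1 :> K by rewrite -natr1.
have jr : in_range N n R (j.+1%:R : K).
  by rewrite /in_range ler0n jn' jR' /=; lra.
have rho1 : 1 <= odds_ratio N n R (j%:R : K).
  by apply: odds_ratio_ge1 => //; lra.
have := @hyper_L_gradient K N n R j%:R j.+1%:R pm ltac:(lra) ltac:(lra)
  ltac:(lra) ltac:(lra) jr.
have -> : j.+1%:R - j%:R = 1 :> K by rewrite jS; ring.
rewrite mul1r lerBrDl -/(L j) -/(L j.+1) => grad.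
have := @tail_bound_drop K (L j) (L j.+1) _ ltac:(lra) (ln_ge0 rho1) grad.
rewrite expRN lnK ?posrE ?(lt_le_trans ltr01 rho1) //.
have -> : 1 - (odds_ratio N n R j%:R)^-1
   = N%:R * (j%:R - hyper_mean K N n R) / (j%:R * (N%:R - n%:R - R%:R + j%:R)).
  have W0 : 0 < N%:R - n%:R - R%:R + j%:R :> K by lra.
  have j0 : 0 < j%:R :> K by lra.
  rewrite /odds_ratio invf_div; apply: (mulIf (x := j%:R * (N%:R - n%:R - R%:R + j%:R))).
    by rewrite gt_eqF // mulr_gt0.
  rewrite mulrBl mul1r !divfK ?gt_eqF ?mulr_gt0 //.
  by rewrite (@cross_difference K _ _ _ _ pm); ring.
move=> drop.
rewrite -(ler_pM2r (expR_gt0 (L j))); apply: (le_trans hH).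
move: drop; rewrite expRN ler_pdivrMr ?expR_gt0 // => drop.
by rewrite -[X in X <= _]mulrA -[X in _ <= X]mulrA ler_wpM2l ?(ltW C0).
Qed.

(** At the end of the range one of the cells below expectation is empty, so the
    odds ratio is infinite and the drop of the bound is the bound itself. *)
Lemma hyper_pmf_last (K : realType) (N n R j : nat) :
  let L (i : nat) := hyper_L N n R (i%:R : K) in
  proper_margins N n R -> j = minn n R -> (n - j <= N - R)%N ->
  hyper_mean K N n R < j%:R -> 3 / 2 <= L j ->
  hyper_pmf K N n R j <= hyper_C K N n R * tail_bound (L j).
Proof.
move=> L pm jE nj mj L2.
have [n0 R0 nN RN] := @proper_margins_real K _ _ _ pm.
have [m1 m2 m3 m4] := @expected_cells_gt0 K _ _ _ pm.
have C0 : 0 < hyper_C K N n R by rewrite /hyper_C mulr_gt0 ?expR_gt0.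
have jn : (j <= n)%N by rewrite jE geq_minl.
have jR : (j <= R)%N by rewrite jE geq_minr.
have hH := @hyper_pmf_le K _ _ _ _ pm jn jR nj mj L2.
have W0 : 0 < N%:R - n%:R - R%:R + j%:R :> K by lra.
have j0 : 0 < j%:R :> K by lra.
have one : N%:R * (j%:R - hyper_mean K N n R)
    = j%:R * (N%:R - n%:R - R%:R + j%:R).
  rewrite (@cross_difference K _ _ _ _ pm).
  have -> : (n%:R - j%:R) * (R%:R - j%:R) = 0 :> K.
    by rewrite jE /minn; case: ltnP => _; rewrite subrr ?mul0r ?mulr0.
  by rewrite add0r.
rewrite one divff ?gt_eqF ?mulr_gt0 // mulr1 in hH.
move: (hyper_C K N n R) C0 hH => C C0 hH.
rewrite -(ler_pM2r (expR_gt0 (L j))); apply: (le_trans hH).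
rewrite /tail_bound -!mulrA -expRD addNr expR0 mulr1 ler_wpM2l ?(ltW C0) //.
by rewrite lerD2l ler1n.
Qed.

(** Above the mean, the constraint on the last cell holds by itself: that cell is
    larger than its positive expectation. *)
Lemma above_mean_slack (K : realType) (N n R j : nat) : proper_margins N n R ->
  (j <= n)%N -> hyper_mean K N n R < j%:R -> (n - j <= N - R)%N.
Proof.
move=> pm jn mj; have [/andP[_ nN] /andP[_ RN]] := andP pm.
have [m1 m2 m3 m4] := @expected_cells_gt0 K _ _ _ pm.
rewrite -(ler_nat K) !natrB ?(ltnW RN) //; lra.
Qed.

Lemma hyper_tail_le (K : realType) (N n R k : nat) :
  let L (i : nat) := hyper_L N n R (i%:R : K) in
  proper_margins N n R -> (k <= minn n R)%N -> hyper_mean K N n R < k%:R ->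
  3 / 2 <= L k ->
  \sum_(k <= j < (minn n R).+1) hyper_pmf K N n R j
    <= hyper_C K N n R * tail_bound (L k).
Proof.
move=> L pm; move e : (minn n R - k)%N => i.
elim: i k e => [|i IH] k e kM mk L2.
  have kE : k = minn n R by apply/eqP; rewrite eqn_leq kM -subn_eq0 e.
  rewrite kE big_nat1 -kE; apply: hyper_pmf_last => //.
  by apply: (@above_mean_slack K) => //; rewrite kE geq_minl.
have kM' : (k < minn n R)%N by rewrite -subn_gt0 e.
have /andP[kn kR] : (k < n)%N && (k < R)%N by rewrite -leq_min.
rewrite big_ltn // ?ltnS //.
have [n0 R0 nN RN] := @proper_margins_real K _ _ _ pm.
have [m1 m2 m3 m4] := @expected_cells_gt0 K _ _ _ pm.
have kS : k%:R <= k.+1%:R :> K by rewrite ler_nat.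
have kn' : k.+1%:R <= n%:R :> K by rewrite ler_nat.
have kR' : k.+1%:R <= R%:R :> K by rewrite ler_nat.
have kr : in_range N n R (k.+1%:R : K).
  by rewrite /in_range ler0n kn' kR' /=; lra.
have LS : L k <= L k.+1 by apply: hyper_L_homo => //; apply: ltW.
have h1 := @hyper_pmf_telescope K N n R k pm kn kR
  (@above_mean_slack K _ _ _ _ pm (ltnW kn) mk) mk L2.
have h2 := IH k.+1 ltac:(by rewrite subnS e) kM' (lt_le_trans mk kS) (le_trans L2 LS).
by move: (lerD h1 h2); rewrite mulrBr subrK.
Qed.

(** * Exchanging the colours *)

Lemma hyper_mean_compl (K : realType) (N n R : nat) : proper_margins N n R ->
  hyper_mean K N n (N - R) = n%:R - hyper_mean K N n R.
Proof.
move=> pm; have [n0 R0 nN RN] := @proper_margins_real K _ _ _ pm.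
have /andP[_ /andP[_ RN']] := pm.
by rewrite /hyper_mean natrB ?(ltnW RN') //; field; neq0.
Qed.

Lemma hyper_C_compl (K : realType) (N n R : nat) : proper_margins N n R ->
  hyper_C K N n (N - R) = hyper_C K N n R.
Proof.
move=> pm; have [n0 R0 nN RN] := @proper_margins_real K _ _ _ pm.
have /andP[_ /andP[_ RN']] := pm.
rewrite /hyper_C natrB ?(ltnW RN') //; congr (2 * expR _).
by field; neq0.
Qed.

Lemma hyper_L_compl (K : realType) (N n R : nat) (x : K) : proper_margins N n R ->
  hyper_L N n (N - R) (n%:R - x) = hyper_L N n R x.
Proof.
move=> pm; have [n0 R0 nN RN] := @proper_margins_real K _ _ _ pm.
have /andP[_ /andP[_ RN']] := pm.
rewrite /hyper_L /bernoulli_divergence natrB ?(ltnW RN') //.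
have -> : (n%:R - x) / n%:R = 1 - x / n%:R by field; neq0.
have -> : (N%:R - R%:R) / N%:R = 1 - R%:R / N%:R :> K by field; neq0.
have -> : (N%:R - R%:R - (n%:R - x)) / (N%:R - n%:R)
   = 1 - (R%:R - x) / (N%:R - n%:R) by field; neq0.
have sub2 (a : K) : 1 - (1 - a) = a by ring.
by rewrite !sub2; ring.
Qed.

Lemma in_range_compl (K : realType) (N n R : nat) (x : K) : (R <= N)%N ->
  in_range N n (N - R) (n%:R - x) = in_range N n R x.
Proof.
move=> RN; rewrite /in_range natrB //.
by apply/and4P/and4P => -[? ? ? ?]; split; lra.
Qed.

Lemma proper_margins_compl (N n R : nat) :
  proper_margins N n R -> proper_margins N n (N - R).
Proof. by rewrite /proper_margins; lia. Qed.

Lemma hyper_L_antihomo (K : realType) (N n R : nat) (x y : K) :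
  proper_margins N n R -> y <= hyper_mean K N n R -> x <= y ->
  in_range N n R x -> hyper_L N n R y <= hyper_L N n R x.
Proof.
move=> pm ym xy xr; have /andP[_ /andP[_ RN]] := pm.
rewrite -(@hyper_L_compl K _ _ _ x pm) -(@hyper_L_compl K _ _ _ y pm).
apply: hyper_L_homo; first exact: proper_margins_compl.
- by rewrite (@hyper_mean_compl K _ _ _ pm) lerD2l lerN2.
- by rewrite lerD2l lerN2.
- by rewrite in_range_compl // ltnW.
Qed.

(** * From tail sums to sets of draws *)

(** A draw is determined by its red part and its other part. *)
Lemma card_draws_split (T : finType) (red : {set T}) (n j : nat) :
  (#|[set A : {set T} | (#|A| == n) && (#|A :&: red| == j)]%SET|
    <= 'C(#|red|, j) * 'C(#|T| - #|red|, n - j))%N.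
Proof.
pose f (A : {set T}) := (A :&: red, A :\: red).
rewrite -(card_in_imset (f := f)); last first.
  by move=> A B _ _ [eI eD]; rewrite -(setID A red) eI eD setID.
have <- : #|~: red| = (#|T| - #|red|)%N by rewrite -(cardsC red) addKn.
rewrite -!cards_draws -cardsX; apply: subset_leq_card.
apply/fintype.subsetP => _ /imsetP[A + ->]; rewrite !inE => /andP[/eqP An /eqP Aj].
rewrite subsetIr Aj eqxx /= cardsD An Aj eqxx andbT.
by apply/fintype.subsetP => x; rewrite !inE => /andP[].
Qed.

Lemma draw_in_range (K : realType) (T : finType) (red A : {set T}) (n : nat) :
  #|A| = n -> in_range #|T| n #|red| (#|A :&: red|%:R : K).
Proof.
move=> An; rewrite /in_range ler0n !ler_nat -An !subset_leq_card ?subsetIl ?subsetIr //=.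
have := max_card (mem (A :|: red)); have := cardsUI A red.
rewrite -(ler_nat K) => /(congr1 (fun k => k%:R : K)); rewrite !natrD; lra.
Qed.

(** Among the draws in [E] take one with the fewest red items, [k] say: then [E]
    is contained in the tail starting at [k], and [t <= L k].  This way only
    integer arguments of [L] are needed, and the same statement covers the events
    [x <= X] and [x <= L X].  For [t <= 3/2] the bound is at least [1]. *)
Lemma card_above_mean_le (K : realType) (T : finType) (red : {set T}) (n : nat)
    (t : K) (E : {set {set T}}) :
  let N := #|T| in let R := #|red| in
  proper_margins N n R -> 0 <= t ->
  (forall A, A \in E -> [/\ #|A| = n, hyper_mean K N n R < #|A :&: red|%:R &
      t <= hyper_L N n R (#|A :&: red|%:R : K)]) ->
  #|E|%:R / 'C(N, n)%:R <= hyper_C K N n R * tail_bound t.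
Proof.
move=> N R pm t0 hE.
have /andP[/andP[_ nN] _] := pm.
have C2 := @hyper_C_ge2 K _ _ _ pm.
have bin0 : 0 < 'C(N, n)%:R :> K by rewrite ltr0n bin_gt0 ltnW.
have F0 : 0 <= tail_bound t by rewrite mulr_ge0 ?expR_ge0 // addr_ge0.
have [t1|t1] := lerP t (3 / 2).
  apply: le_trans (_ : 1 <= _).
    rewrite ler_pdivrMr // mul1r ler_nat -card_draws; apply: subset_leq_card.
    by apply/fintype.subsetP => A /hE[An _ _]; rewrite inE An.
  by apply: le_trans (@tail_bound_small K t t0 t1) _; rewrite ler_wpM2r.
have [->|[A0 A0E]] := set_0Vmem E.
  by rewrite cards0 mul0r mulr_ge0 //; lra.
case: (arg_minnP (fun A : {set T} => #|A :&: red|) A0E) => A1 A1E A1min.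
have [A1n A1m A1L] := hE _ A1E.
set k := #|A1 :&: red| in A1min A1m A1L.
have inter_le A : A \in E -> (#|A :&: red| <= minn n R)%N.
  by move=> /hE[<- _ _]; rewrite leq_min !subset_leq_card ?subsetIl ?subsetIr.
have count : (#|E| <= \sum_(k <= j < (minn n R).+1) 'C(R, j) * 'C(N - R, n - j))%N.
  apply: (@leq_trans (\sum_(k <= j < (minn n R).+1)
                        \sum_(A in E) (#|A :&: red| == j))); last first.
    apply: leq_sum => j _; apply: leq_trans _ (card_draws_split T red n j).
    rewrite -big_mkcondr /= sum1_card; apply: subset_leq_card.
    apply/fintype.subsetP => A; rewrite inE => /andP[/hE[An _ _] Aj].
    by rewrite An eqxx.
  rewrite exchange_big /= -sum1_card; apply: leq_sum => A AE.
  rewrite (bigD1_seq #|A :&: red|) ?iota_uniq //=; last first.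
    by rewrite mem_index_iota ltnS inter_le // A1min.
  by rewrite eqxx leq_addr.
apply: le_trans (_ : \sum_(k <= j < (minn n R).+1) hyper_pmf K N n R j <= _).
  rewrite /hyper_pmf -mulr_suml -natr_sum ler_pM2r ?invr_gt0 //.
  by rewrite ler_nat.
apply: le_trans (@hyper_tail_le K N n R k pm (inter_le _ A1E) A1m _) _.
  by apply: le_trans A1L; exact: ltW.
by rewrite ler_wpM2l ?tail_bound_nincr //; lra.
Qed.

(** Few red items means many items of the other colour. *)
Lemma card_below_mean_le (K : realType) (T : finType) (red : {set T}) (n : nat)
    (t : K) (E : {set {set T}}) :
  let N := #|T| in let R := #|red| in
  proper_margins N n R -> 0 <= t ->
  (forall A, A \in E -> [/\ #|A| = n, #|A :&: red|%:R < hyper_mean K N n R &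
      t <= hyper_L N n R (#|A :&: red|%:R : K)]) ->
  #|E|%:R / 'C(N, n)%:R <= hyper_C K N n R * tail_bound t.
Proof.
move=> N R pm t0 hE.
have compl : #|~: red| = (N - R)%N by rewrite /N -(cardsC red) addKn.
rewrite -(@hyper_C_compl K _ _ _ pm) -compl.
apply: card_above_mean_le => //; rewrite compl; first exact: proper_margins_compl.
move=> A /hE[An Am AL].
have -> : #|A :&: ~: red|%:R = n%:R - #|A :&: red|%:R :> K.
  by rewrite -finset.setDE -An -[in RHS](cardsID red A) natrD addrC addKr.
by rewrite (@hyper_mean_compl K _ _ _ pm) (@hyper_L_compl K _ _ _ _ pm) ltrD2l ltrN2.
Qed.

(** * Tail probabilities *)

(** The values of [D] that are not [n]-element sets have probability [0], so they
    may belong to the event. *)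
Lemma uniform_draw_event (K : realType) (d : measure_display)
    (Omega : measurableType d) (P : probability Omega K) (T : finType) (n : nat)
    (D : Omega -> {set T}) (Q : pred {set T}) :
  uniform_draw P n D ->
  P [set w | Q (D w)]
    = (#|[set A : {set T} | (#|A| == n) && Q A]%SET|%:R / 'C(#|T|, n)%:R)%:E.
Proof.
move=> drawD.
have -> : [set w | Q (D w)] = \bigcup_(A in [set` enum Q]) [set w | D w = A].
  apply/seteqP; split => [w /= Qw|w [A /=]]; last by rewrite mem_enum => QA ->.
  by exists (D w) => //=; rewrite mem_enum.
rewrite measure_fin_bigcup //=; first last.
- by move=> A _; have [] := drawD A.
- by move=> A B _ _ [w [/= <- <-]].
rewrite -fsbig_seq ?enum_uniq // big_enum /=.
under eq_bigr => A _ do rewrite (proj2 (drawD A)).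
rewrite sumEFin -big_mkcondr /= sumr_const; congr (_%:E).
rewrite -[LHS]mulr_natl; congr (_%:R * _).
by apply: eq_card => A; rewrite !inE andbC.
Qed.

Theorem theorem4 (K : realType) (N n R : nat)
    (n_gt0 : (0 < n)%N) (n_lt : (n < N)%N) (R_gt0 : (0 < R)%N) (R_lt : (R < N)%N)
    (T : finType) (red : {set T}) (cardT : #|T| = N) (card_red : #|red| = R)
    (d : measure_display) (Omega : measurableType d) (P : probability Omega K)
    (D : Omega -> {set T}) (drawD : uniform_draw P n D) :
  let X : Omega -> K := fun w => (red_drawn red D w)%:R in
  let m : K := n%:R * R%:R / N%:R in
  let L : K -> K := hyper_L N n R in
  let C : K := hyper_C K N n R in
  (forall x : K,
     Num.max 0 (n%:R + R%:R - N%:R) <= x <= Num.min n%:R R%:R ->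
     (m < x ->
        (P [set w | x <= X w]%R <= (C * (L x + 2) * expR (- L x))%:E)%E) /\
     (x < m ->
        (P [set w | X w <= x]%R <= (C * (L x + 2) * expR (- L x))%:E)%E)) /\
  (forall x : K, 0 < x ->
     (P [set w | x <= L (X w)]%R <= (2 * C * (x + 2) * expR (- x))%:E)%E).
Proof.
have pm : proper_margins N n R by rewrite /proper_margins n_gt0 n_lt R_gt0 R_lt.
subst N R; set N := #|T| in n_lt R_lt pm *; set R := #|red| in R_gt0 R_lt pm *.
move=> X m L C.
have mE : m = hyper_mean K N n R by [].
have rangeE (A : {set T}) : #|A| = n -> in_range N n R (#|A :&: red|%:R : K).
  exact: draw_in_range.
pose event (Q : pred {set T}) := [set A : {set T} | (#|A| == n) && Q A]%SET.
split=> [x|x x0].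
  rewrite ge_max le_min => /andP[/andP[x1 x2] /andP[x3 x4]].
  have xr : in_range N n R x by rewrite /in_range x1 x3 x4 /=; lra.
  have L0 : 0 <= L x by exact: hyper_L_ge0.
  rewrite -mulrA -/(tail_bound (L x)).
  split=> [mx|xm].
    have -> := @uniform_draw_event K d Omega P T n D
      (fun A => x <= #|A :&: red|%:R) drawD.
    rewrite lee_fin; apply: card_above_mean_le => // A.
    rewrite inE => /andP[/eqP An xA]; split=> //; first exact: lt_le_trans xA.
    by apply: hyper_L_homo => //; [exact: ltW | exact: rangeE].
  have -> := @uniform_draw_event K d Omega P T n D
    (fun A => #|A :&: red|%:R <= x) drawD.
  rewrite lee_fin; apply: card_below_mean_le => // A.
  rewrite inE => /andP[/eqP An xA]; split=> //; first exact: le_lt_trans xm.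
  by apply: hyper_L_antihomo => //; [exact: ltW | exact: rangeE].
have -> := @uniform_draw_event K d Omega P T n D
  (fun A => x <= L #|A :&: red|%:R) drawD.
rewrite lee_fin.
have -> : 2 * C * (x + 2) * expR (- x) = C * tail_bound x + C * tail_bound x.
  by rewrite /tail_bound; ring.
pose up := event (fun A => (m < #|A :&: red|%:R) && (x <= L #|A :&: red|%:R)).
pose dn := event (fun A => (#|A :&: red|%:R < m) && (x <= L #|A :&: red|%:R)).
have hup : #|up|%:R / 'C(N, n)%:R <= C * tail_bound x.
  apply: card_above_mean_le => //; first exact: ltW.
  by move=> A; rewrite inE => /andP[/eqP An /andP[? ?]].
have hdn : #|dn|%:R / 'C(N, n)%:R <= C * tail_bound x.
  apply: card_below_mean_le => //; first exact: ltW.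
  by move=> A; rewrite inE => /andP[/eqP An /andP[? ?]].
apply: le_trans _ (lerD hup hdn); rewrite -mulrDl ler_wpM2r ?invr_ge0 // -natrD ler_nat.
apply: leq_trans _ (leq_card_setU up dn).
apply: subset_leq_card; apply/fintype.subsetP => A.
rewrite !inE => /andP[An xA]; rewrite An xA !andbT /=.
have := rangeE A (eqP An) => Ar.
have := le_trans xA (@hyper_L_le K N n R _ pm Ar); rewrite -mE.
case: (ltrgtP m #|A :&: red|%:R) => // <-.
by rewrite subrr expr0n mul0r => /(lt_le_trans x0); rewrite ltxx.
Qed.
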